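(* There is an algorithm that, given a string $w[1..n]$ and its $\mathcal{MRC}$ array, correctly computes all maximal closed substrings (MCSs) of $w$ in $\mathcal{O}(n\log n)$ time.
   Context: Strings are indexed from 1; $w[i..j]$ denotes the substring (occurrence) from position $i$ to $j$. A border of a string $x$ is a nonempty string that is both a proper prefix and a proper suffix of $x$. A string $x$ is closed if $|x|=1$, or $|x|\ge2$ and $x$ has a border occurring in $x$ only as a prefix and as a suffix and nowhere else. An occurrence $w[i..j]$ is maximal right-closed if it is closed and either $j=n$ or $w[i..j+1]$ is not closed; it is maximal left-closed if it is closed and either $i=1$ or $w[i-1..j]$ is not closed. A maximal closed substring (MCS) is an occurrence that is both maximal left-closed and maximal right-closed. For a position $i$, let $r_1,\ldots,r_{K_i}$ be the maximal right-closed occurrences starting at $i$ with $|r_1|<\cdots<|r_{K_i}|$, and let $b_j$ be the longest border of $r_j$ ($|b_j|=0$ if $|r_j|=1$). The $\mathcal{MRC}$ array of $w$ is the array of length $n$ whose entry $\mathcal{MRC}[i]$ is the list of pairs $(|r_j|,|b_j|)$ for $j=K_i$ down to $1$. *)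

(* Defs.v *)
From mathcomp Require Import all_boot.

Set Implicit Arguments.
Unset Strict Implicit.
Unset Printing Implicit Defensive.

Section Strings.
Variable T : eqType.
Implicit Types (b x w : seq T) (i j p : nat).

(* Positions are 1-based; meaningful for 1 <= i <= j <= size w. *)
Definition substr w i j := take (j.+1 - i) (drop i.-1 w).

Definition border b x :=
  [&& b != [::], prefix b x, suffix b x & b != x].

Definition borders x :=
  [seq b <- [seq take k x | k <- iota 0 (size x).+1] | border b x].

Lemma mem_borders x b : (b \in borders x) = border b x.
Proof.
rewrite mem_filter andb_idr // => /and4P[_ + _ _]; rewrite prefixE => /eqP <-.
have [le_bx|lt_xb] := leqP (size b) (size x).
  by apply: (map_f (take^~ x)); rewrite mem_iota add0n ltnS.
rewrite take_oversize; last exact: ltnW.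
by apply/mapP; exists (size x); rewrite ?take_size // mem_iota add0n ltnSn.
Qed.

(* Starting positions, 1-based, of the occurrences in x of a nonempty b. *)
Definition occurrences b x :=
  [seq p <- iota 1 (size x) | prefix b (drop p.-1 x)].

Definition closed x :=
  (size x == 1) ||
  (2 <= size x) &&
  has (fun b => all (fun p => (p == 1) || (p == (size x - size b).+1))
                    (occurrences b x))
      (borders x).

Definition max_right_closed w i j :=
  [&& 1 <= i, i <= j, j <= size w, closed (substr w i j)
    & (j == size w) || ~~ closed (substr w i j.+1)].

Definition max_left_closed w i j :=
  [&& 1 <= i, i <= j, j <= size w, closed (substr w i j)
    & (i == 1) || ~~ closed (substr w i.-1 j)].

Definition MCS w i j := max_left_closed w i j && max_right_closed w i j.

(* 0 when x has no border, in particular when size x = 1. *)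
Definition longest_border x := \max_(b <- borders x) size b.

(* The ends j are enumerated increasingly, so the reversal lists the maximal
   right-closed occurrences starting at i by decreasing length. *)
Definition MRC_entry w i : seq (nat * nat) :=
  [seq (size (substr w i j), longest_border (substr w i j))
  | j <- rev [seq j <- iota 1 (size w) | max_right_closed w i j]].

Definition MRC w : seq (seq (nat * nat)) :=
  [seq MRC_entry w i | i <- iota 1 (size w)].

End Strings.

(* A word RAM with W-bit words.  A program uses the finitely many registers it
   names; memory is addressed by words, and output is write-only.  Every basic
   instruction and every evaluation of a test takes unit time. *)

Definition reg := nat.

Inductive test :=
  | TEq of reg & reg
  | TLt of reg & reg.

Inductive prog :=
  | Skip
  | Const of reg & nat
  | Move of reg & reg
  | Add of reg & reg & reg
  | Sub of reg & reg & reg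
  | LoadMem of reg & reg
  | StoreMem of reg & reg
  | Output of reg
  | Seq of prog & prog
  | If of test & prog & prog
  | While of test & prog.

Record state := State {
  regs : reg -> nat;
  mem : nat -> nat;
  out : seq nat
}.

Definition eval_test (t : test) (s : state) : bool :=
  match t with
  | TEq x y => regs s x == regs s y
  | TLt x y => regs s x < regs s y
  end.

Definition set_reg (W : nat) (s : state) (x : reg) (v : nat) :=
  State [eta regs s with x |-> v %% 2 ^ W] (mem s) (out s).

(* [exec W P s t s']: started in s, the program P halts in s' after exactly
   t units of time. *)
Inductive exec (W : nat) : prog -> state -> nat -> state -> Prop :=
  | ESkip s : exec W Skip s 1 s
  | EConst s x c : exec W (Const x c) s 1 (set_reg W s x c)
  | EMove s x y : exec W (Move x y) s 1 (set_reg W s x (regs s y))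
  | EAdd s x y z :
      exec W (Add x y z) s 1 (set_reg W s x (regs s y + regs s z))
  | ESub s x y z :
      exec W (Sub x y z) s 1 (set_reg W s x (regs s y + 2 ^ W - regs s z))
  | ELoad s x y :
      exec W (LoadMem x y) s 1 (set_reg W s x (mem s (regs s y)))
  | EStore s x y :
      exec W (StoreMem x y) s 1
        (State (regs s) [eta mem s with regs s x |-> regs s y] (out s))
  | EOutput s x :
      exec W (Output x) s 1 (State (regs s) (mem s) (rcons (out s) (regs s x)))
  | ESeq P Q s1 s2 s3 t u :
      exec W P s1 t s2 -> exec W Q s2 u s3 -> exec W (Seq P Q) s1 (t + u) s3
  | EIf b P Q s s' t :
      exec W (if eval_test b s then P else Q) s t s' ->
      exec W (If b P Q) s t.+1 s'
  | EWhileF b P s : ~~ eval_test b s -> exec W (While b P) s 1 s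
  | EWhileT b P s1 s2 s3 t u :
      eval_test b s1 -> exec W P s1 t s2 -> exec W (While b P) s2 u s3 ->
      exec W (While b P) s1 (t + u).+1 s3.

Lemma exec_det W P s t1 s1 t2 s2 :
  exec W P s t1 s1 -> exec W P s t2 s2 -> t1 = t2 /\ s1 = s2.
Proof.
move=> e; elim: e t2 s2 => {P s t1 s1}.
1-8: by move=> *; match goal with H : exec _ _ _ _ _ |- _ => inversion H end.
- move=> P Q s1 s2 s3 t u _ IHP _ IHQ t2 s4 e.
  inversion_clear e as [| | | | | | | |? ? ? s2' ? ? ? eP eQ| | |].
  have [-> E] := IHP _ _ eP; rewrite -E in eQ.
  by have [-> ->] := IHQ _ _ eQ.
- move=> b P Q s s' t _ IH t2 s2 e.
  inversion_clear e as [| | | | | | | | |? ? ? ? ? ? eI| |].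
  by have [-> ->] := IH _ _ eI.
- move=> b P s nb t2 s2 e; inversion e as [| | | | | | | | | | |]; subst => //.
  by case/negP: nb.
- move=> b P s1 s2 s3 t u bT _ IHP _ IHW t2 s4 e.
  inversion e as [| | | | | | | | | |? ? ? nb|? ? ? s2' ? ? ? ? eP eW]; subst.
    by case/negP: nb.
  have [-> E] := IHP _ _ eP; rewrite -E in eW.
  by have [-> ->] := IHW _ _ eW.
Qed.

Definition init (input : seq nat) : state :=
  State (fun=> 0) (fun a => nth 0 input a) [::].

(* Every input word and every input address is representable on W bits. *)
Definition fits (W : nat) (input : seq nat) : bool :=
  (size input < 2 ^ W) && all (fun v => v < 2 ^ W) input.

Definition flat_pairs (L : seq (nat * nat)) : seq nat :=
  flatten [seq [:: p.1; p.2] | p <- L].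

(* A list is stored as its number of pairs followed by the pairs. *)
Definition encode_list (L : seq (nat * nat)) : seq nat :=
  size L :: flat_pairs L.

(* Memory layout for a string w of length n and an array A of n lists:
     cell 0           n
     cells 1 .. n     w[1], ..., w[n]
     cell n + i       address of the encoding of A[i], for 1 <= i <= n
     cells 2n + 1 ..  the encodings of A[1], ..., A[n]. *)
Definition encode_input (w : seq nat) (A : seq (seq (nat * nat))) : seq nat :=
  let n := size w in
  let blocks := [seq encode_list L | L <- A] in
  n :: w ++ [seq (2 * n).+1 + sumn (take k (shape blocks)) | k <- iota 0 n]
         ++ flatten blocks.

(* Main.v *)
(* An occurrence w[i..j] closed with longest border u, |u| = k, is a pair of
   consecutive occurrences of u, at i and p = j - k + 1.  It extends to the left
   (right) into a closed word exactly when the letters preceding (following) i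
   and p (i + k and p + k) coincide.  Hence the MCSs are the occurrences listed
   in MRC for which i = 1 or w[i - 1] <> w[p - 1], and one pass over MRC finds
   them in constant time per entry.

   There are O(n log n) entries.  At a maximal right-closed occurrence, u is
   followed by distinct letters at i and p, so one of i, p belongs to an
   extension of u that has at most half as many occurrences as u.  A position q
   is in that situation for at most log n lengths k, and (q, k) is charged at
   most twice since i and p determine each other. *)
Require Import Defs.
From mathcomp Require Import all_boot.
From mathcomp Require Import zify.
Import Defs.

Set Implicit Arguments.
Unset Strict Implicit.
Unset Printing Implicit Defensive.

(** * Closed words as first returns of a prefix *)

Section Closed.
Variable T : eqType.
Implicit Types (a : T) (b x y w : seq T) (i j k d e m : nat).

(* For k = 0 the last condition forces d = 1: a single letter is treated like the
   other closed words, as the return from one occurrence of the empty word to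
   the next. *)
Definition first_return k d x :=
  [/\ 0 < d, k + d <= size x, take k (drop d x) = take k x
    & forall e, 0 < e < d -> take k (drop e x) <> take k x].

Lemma take_takeE k l x y : k <= l -> take l x = take l y -> take k x = take k y.
Proof. by move=> lekl /(congr1 (take k)); rewrite !take_takel. Qed.

Lemma take_drop_take k e m y :
  k + e <= m -> take k (drop e (take m y)) = take k (drop e y).
Proof. by move=> le; rewrite take_drop take_takel ?take_drop //; lia.
Qed.

(** Only the first [k + d] letters matter, so a factor of [w] can be replaced by the suffix of [w]
    that it begins. *)
Lemma first_return_take k d m y : k + d <= m -> m <= size y ->
  first_return k d (take m y) <-> first_return k d y.
Proof.
move=> le1 le2; rewrite /first_return size_takel //.
have E e : e <= d -> take k (drop e (take m y)) = take k (drop e y).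
  by move=> le; apply: take_drop_take; lia.
have E0 : take k (take m y) = take k y by rewrite take_takel //; lia.
split=> -[d0 l1 eq ne]; split=> //; try lia.
- by rewrite -E // eq.
- by move=> e /andP[e0 ed]; rewrite -E ?(ltnW ed) // -E0; apply: ne; rewrite e0.
- by rewrite E // E0.
- by move=> e /andP[e0 ed]; rewrite E ?(ltnW ed) // E0; apply: ne; rewrite e0.
Qed.

Lemma borderP b x :
  reflect [/\ 0 < size b < size x, b = take (size b) x
            & b = drop (size x - size b) x] (border b x).
Proof.
apply: (iffP idP) => [/and4P[bn0 pr su ne]|[/andP[b0 bx] pr su]].
  have lt : size b < size x.
    rewrite ltn_neqAle size_prefix // andbT.
    apply: contra ne => /eqP eq; move: pr; rewrite prefixE eq take_size.
    by move=> /eqP->.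
  split; first by rewrite lt0n size_eq0 bn0.
    by move: pr; rewrite prefixE => /eqP.
  by move: su; rewrite suffixE => /eqP.
apply/and4P; split.
- by rewrite -size_eq0 -lt0n.
- by rewrite prefixE -pr.
- by rewrite suffixE -su.
- by apply: contraTneq bx => ->; rewrite ltnn.
Qed.

Lemma border_take k x : 0 < k < size x ->
  take k (drop (size x - k) x) = take k x -> border (take k x) x.
Proof.
move=> /andP[k0 kx] eq; apply/borderP; rewrite size_takel ?(ltnW kx) //.
split=> //; first by rewrite k0.
by rewrite -eq take_oversize // size_drop; lia.
Qed.

(** The border witnessing closedness has length [k] and its two occurrences lie [d] apart; [k = 0]
    covers single letters. *)
Lemma closedP x :
  reflect (exists k d, first_return k d x /\ size x = k + d) (closed x).
Proof.
apply: (iffP idP).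
  case/orP=> [/eqP s1|/andP[s2 /hasP[b]]].
    exists 0, 1; split; last by rewrite s1.
    by split; rewrite ?s1 ?take0 // => e; lia.
  rewrite mem_borders => /borderP[/andP[b0 bx] pr su] /allP occ.
  exists (size b), (size x - size b); split; last by lia.
  split; [lia|lia| |].
    by rewrite -su -pr take_size.
  move=> e /andP[e0 ed] eq.
  have /occ : e.+1 \in occurrences b x.
    by rewrite mem_filter mem_iota /= prefixE eq -pr eqxx; lia.
  lia.
move=> [k [d [[d0 _ eq ne] s]]].
have [k0|k0] := posnP k.
  have d1 : d = 1.
    case: d d0 ne {eq s} => [|[|d]] // _ /(_ 1 isT); rewrite k0 !take0.
    by case.
  by rewrite /closed s k0 d1.
apply/orP; right; apply/andP; split; first by lia.
apply/hasP; exists (take k x).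
  by rewrite mem_borders; apply: border_take; [lia | rewrite s addKn].
apply/allP=> p; rewrite mem_filter mem_iota prefixE size_takel ?s; last by lia.
move=> /andP[/eqP pe le]; case: (p == 1) / eqP => //= p1.
(* [take] truncates silently; comparing sizes shows that the occurrence fits inside [x], so
   [p.-1 <= d]. *)
have := congr1 size pe; rewrite size_take size_drop size_takel ?s; last by lia.
have [->|pd] := eqVneq p (k + d - k).+1; first by [].
move=> sz; case: (ne p.-1) => //; move: sz pd; case: ltnP; lia.
Qed.

(** A longer border would bring the prefix of length [k] back before distance [d]. *)
Lemma longest_border_first_return k d x :
  first_return k d x -> size x = k + d -> longest_border x = k.
Proof.
move=> [d0 _ eq ne] s; apply/eqP; rewrite eqn_leq; apply/andP; split.
  apply/bigmax_leqP_seq => b; rewrite mem_borders => /borderP[lt pr su] _.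
  rewrite leqNgt; apply/negP=> kb; apply: (ne (size x - size b)); first by lia.
  by apply: take_takeE (ltnW kb) _; rewrite -su -pr take_size.
have [->//|k0] := posnP k.
have bk : take k x \in borders x.
  by rewrite mem_borders; apply: border_take; [lia | rewrite s addKn].
by apply: leq_trans (leq_bigmax_seq _ bk isT); rewrite size_takel //; lia.
Qed.

Lemma first_return_cons k d a x : k + d <= size x ->
  first_return k d x -> a = nth a (a :: x) d -> first_return k.+1 d (a :: x).
Proof.
case: d => [|d] kd [] // _ _ eq ne /= ad; split=> //=.
  have ltd : d < size x by lia.
  by rewrite (drop_nth a) //= eq -ad.
case=> [|e] // /andP[_ ed] /=.
have lte : e < size x by lia.
by rewrite (drop_nth a) //= => -[_]; apply: ne; lia.
Qed.

(** The border that closes [a :: x] can only be that of [x] with one letter prepended, at the same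
    distance; both other lengths contradict a first return. *)
Lemma closed_cons a x : closed x ->
  closed (a :: x) = (a == nth a (a :: x) (size x - longest_border x)).
Proof.
move=> /closedP[k [d [fr s]]]; rewrite (longest_border_first_return fr s).
rewrite s addKn; apply/closedP/eqP; last first.
  move=> eq; exists k.+1, d; split; last by rewrite /= s.
  by apply: first_return_cons => //; rewrite s.
case: fr => d0 _ eq ne [k' [d' [[d'0 _ eq' ne'] /= s']]].
have [le|lt] := leqP k' k.
  (* Here [d < d']. The short border ends the suffix copy of the [k]-border of [x], hence also its
     prefix copy, and so it already returns at [d' - d]. *)
  case: (ne' (d' - d)); first by lia.
  have -> : d' - d = (k - k').+1 by lia.
  rewrite -eq' /=; case: d' d'0 s' {eq' ne'} => //= d' _ s'.
  rewrite (_ : d' = (k - k') + d); last by lia.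
  rewrite -drop_drop -(@take_drop_take k' _ k x); last by lia.
  by rewrite -(@take_drop_take k' _ k (drop d x)) ?eq //; lia.
have [kk|kk] := eqVneq k' k.+1.
  have dd : d' = d by lia.
  move: eq' d0 s; rewrite kk dd; case: (d) => //= e + _ s.
  by rewrite (drop_nth a) ?s; [case|lia].
(* Here [d' < d]. Without its first letter, the long border brings the [k]-prefix of [x] back at
   [d'], too early. *)
case: (ne d'); first by lia.
case: k' kk lt s' eq' {ne'} => // k' _ lt s'.
case: d' d'0 s' => //= d' _ s'; rewrite (drop_nth a); last by lia.
by case=> _; apply: take_takeE; lia.
Qed.

(** * Closed factors and their maximality on either side *)

Lemma substrE w i j : substr w i.+1 j = take (j - i) (drop i w).
Proof. by rewrite /substr subSS. Qed.

Lemma size_substr w i j : 0 < i <= j -> j <= size w ->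
  size (substr w i j) = (j - i).+1.
Proof.
case: i => // i ij jn; rewrite substrE size_takel ?size_drop; lia.
Qed.

Lemma closed_substr w i j : i < j <= size w -> closed (substr w i.+1 j) ->
  exists k d, [/\ j = i + (k + d), first_return k d (drop i w)
                & longest_border (substr w i.+1 j) = k].
Proof.
move=> /andP[ij jn] /closedP[k [d [fr s]]]; exists k, d.
have E : j = i + (k + d) by rewrite -s size_substr //; lia.
split=> //; last exact: longest_border_first_return fr s.
move: fr; rewrite substrE E addKn; apply: (first_return_take _ _).1 => //.
by rewrite size_drop; lia.
Qed.

(** Here [i] and [p] are the 0-based starts of two consecutive occurrences of the border. If their
    one-letter extensions agreed, they would form a first return at the same distance and close the
    factor ending at [j.+1]. *)
Lemma max_right_closed_border w i j : max_right_closed w i.+1 j ->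
  let k := longest_border (substr w i.+1 j) in
  let p := j - k in
  [/\ i < p <= size w, take k (drop p w) = take k (drop i w),
      forall q, i < q < p -> take k (drop q w) <> take k (drop i w),
      p + k = j
    & take k.+1 (drop p w) <> take k.+1 (drop i w)].
Proof.
case/and5P=> _ ij jn cl mx; have ijn : i < j <= size w by rewrite ij.
have [k [d [jE fr ->]]] := closed_substr ijn cl.
have dE : j - k = i + d by lia.
case: (fr) => d0 _ eq ne; split.
- by lia.
- by rewrite dE addnC -drop_drop.
- move=> q qp; have -> : q = (q - i) + i by lia.
  by rewrite -drop_drop; apply: ne; lia.
- by lia.
have [jsz|jsz] := eqVneq j (size w).
  (* At the end of [w] the factor at [p] is cut to [k] letters, whereas the one at [i] has
     [k.+1]. *)
  move=> /(congr1 size); rewrite !size_take !size_drop.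
  by do 2 case: ltnP; lia.
rewrite dE addnC -drop_drop => eq1.
move: mx; rewrite (negPf jsz) => /negP; apply; apply/closedP.
exists k.+1, d; split; last by rewrite size_substr; lia.
rewrite substrE (_ : j.+1 - i = k.+1 + d); last by lia.
have sz : k.+1 + d <= size (drop i w) by rewrite size_drop; lia.
apply: (first_return_take _ _).2 => //; split=> // e ed eqe.
by apply: (ne e ed); apply: take_takeE eqe.
Qed.

(** This is [closed_cons] for the letter before the occurrence; the two indices are the 0-based ones
    of the letters preceding the two copies of the border. *)
Lemma max_left_closedE (x0 : T) w i j : max_right_closed w i j ->
  max_left_closed w i j =
  (i == 1) ||
  (nth x0 w i.-2 != nth x0 w (j - longest_border (substr w i j)).-1).
Proof.
case: i => [|[|i]] mrc; [by []| |]; case/and5P: (mrc) => _ ij jn cl _;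
  rewrite /max_left_closed ij jn cl //=.
have [/andP[lt _] _ _ pk _] := max_right_closed_border mrc.
have E : substr w i.+1 j = nth x0 w i :: substr w i.+2 j.
  rewrite !substrE (drop_nth x0) ?subnS; last by lia.
  by have ->: j - i = (j - i.+1).+1 by lia.
rewrite E closed_cons // -E.
set k := longest_border _ in lt pk *.
rewrite (set_nth_default x0); last by rewrite !size_substr; lia.
congr (~~ (_ == _)); rewrite substrE nth_take size_substr ?nth_drop; [|lia..].
by congr nth; lia.
Qed.

(** * Counting maximal right-closed occurrences *)

(* Positions are 0-based here.  Position [size w] is included because it is the
   return position of the last letter of w.  A factor cut short by the end of w
   is alone in its class, so the end of w acts as a letter of its own. *)
Definition occ_class w q k :=
  count (fun r => take k (drop r w) == take k (drop q w)) (iota 0 (size w).+1).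

(** One more letter loses at least half of the occurrences: the counterpart of a light edge in the
    suffix trie. *)
Definition light w q k := 2 * occ_class w q k.+1 <= occ_class w q k.

Lemma occ_class_gt0 w q k : q <= size w -> 0 < occ_class w q k.
Proof.
by move=> qw; rewrite -has_count; apply/hasP; exists q; rewrite ?mem_iota ?eqxx.
Qed.

Lemma occ_classS w q k : occ_class w q k.+1 <= occ_class w q k.
Proof.
by apply: sub_count => r /eqP eq; apply/eqP; apply: take_takeE eq.
Qed.

(** As [k] grows the class never grows; it starts with at most [(size w).+1] positions, keeps [q],
    and is at least halved at each light length. *)
Lemma count_light w q k : q <= size w ->
  count (light w q) (iota 0 k) <= trunc_log 2 (size w).+1.
Proof.
move=> qw; apply: trunc_log_max => //.
suff le : 2 ^ count (light w q) (iota 0 k) * occ_class w q k <= (size w).+1.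
  by apply: leq_trans le; rewrite leq_pmulr // occ_class_gt0.
elim: k => [|k IH].
  by rewrite mul1n -[leqRHS](size_iota 0) count_size.
apply: leq_trans IH; rewrite -[in iota 0 k.+1]addn1 iotaD count_cat /= addn0 add0n.
rewrite expnD -mulnA leq_mul2l; apply/orP; right.
case L: (light w q k); first by rewrite expn1.
by rewrite mul1n occ_classS.
Qed.

(** The classes of the two extensions are disjoint parts of one class, so one of them takes at most
    half. *)
Lemma light_or w p q k : take k (drop p w) = take k (drop q w) ->
  take k.+1 (drop p w) <> take k.+1 (drop q w) -> light w p k || light w q k.
Proof.
move=> eq ne.
have E : occ_class w p k = occ_class w q k by rewrite /occ_class eq.
suff : occ_class w p k.+1 + occ_class w q k.+1 <= occ_class w q k.
  by rewrite /light E; lia.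
rewrite /occ_class -count_predUI [X in _ + X](@eq_count _ _ pred0).
  rewrite count_pred0 addn0; apply: sub_count => r /=.
  by case/orP=> /eqP/(take_takeE (leqnSn k)) ->; rewrite ?eq eqxx.
by move=> r /=; apply/negP => /andP[/eqP-> /eqP].
Qed.

Definition mrc_ends w i := [seq j <- iota 1 (size w) | max_right_closed w i j].

Definition mrc_pairs w :=
  [seq (i, j) | i <- iota 0 (size w), j <- mrc_ends w i.+1].

Lemma mem_mrc_pairs w i j : ((i, j) \in mrc_pairs w) = max_right_closed w i.+1 j.
Proof.
apply/allpairsPdep/idP => [[i' [j' [_ + [-> ->]]]]|mrc].
  by rewrite mem_filter => /andP[].
exists i, j; rewrite mem_filter mrc !mem_iota.
by case/and5P: mrc => *; split=> //; lia.
Qed.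

Lemma uniq_mrc_pairs w : uniq (mrc_pairs w).
Proof.
apply: allpairs_uniq_dep => [|i _|[i j] [i' j'] _ _ [-> ->] //].
  exact: iota_uniq.
by rewrite filter_uniq ?iota_uniq.
Qed.

(** The boolean records which copy of the border is charged, the first or the second. *)
Definition light_charge w (ij : nat * nat) :=
  let: (i, j) := ij in
  let k := longest_border (substr w i.+1 j) in
  if light w i k then (true, (i, k)) else (false, (j - k, k)).

(** Given [k] and one copy of the border, the other is the next or the previous occurrence of the
    same factor. *)
Lemma light_charge_inj w : {in mrc_pairs w &, injective (light_charge w)}.
Proof.
move=> [i j] [i' j']; rewrite !mem_mrc_pairs => m m'.
have [lt eq no pk _] := max_right_closed_border m.
have [lt' eq' no' pk' _] := max_right_closed_border m'.
move: lt eq no pk lt' eq' no' pk'; rewrite /light_charge.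
set k := longest_border _; set k' := longest_border _.
move: (j - k) (j' - k') => p p' lt eq no pk lt' eq' no' pk'.
case: ifP => _; case: ifP => _ // [E1 E2].
  rewrite -pk -pk' E2 E1; congr (_, _ + _).
  rewrite -E1 -E2 in lt' eq' no'.
  have [l|l|//] := ltngtP p p'; first by case: (no' p) => //; lia.
  by case: (no p') => //; lia.
rewrite -pk -pk' E2 E1; congr (_, _).
rewrite -E1 -E2 in lt' eq' no'.
have [l|l|//] := ltngtP i i'.
  by case: (no i'); [lia | rewrite -eq' eq].
by case: (no' i); [lia | rewrite -eq eq'].
Qed.

(** Two tags, [n.+1] positions (a return may be at [n]), and logarithmically many light lengths at
    each. *)
Lemma size_mrc_pairs w :
  size (mrc_pairs w) <= 2 * ((size w).+1 * trunc_log 2 (size w).+1).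
Proof.
set n := size w.
pose lights := [seq (q, k) | q <- iota 0 n.+1, k <- [seq k <- iota 0 n | light w q k]].
pose all := [seq (c, qk) | c <- [:: true; false], qk <- lights].
have sub : {subset map (light_charge w) (mrc_pairs w) <= all}.
  move=> _ /mapP[[i j] + ->]; rewrite mem_mrc_pairs => m.
  have [lt eq no pk ne] := max_right_closed_border m.
  have /and5P[_ ij jn _ _] := m.
  have := light_or eq ne; rewrite /light_charge.
  move: lt pk; set k := longest_border _ => lt pk lo.
  have kn : k < n by rewrite /n; lia.
  have [li|li] := boolP (light w i k); apply: allpairs_f; rewrite ?inE //.
    by apply: allpairs_f_dep; rewrite ?mem_filter ?mem_iota ?li /= /n; lia.
  rewrite (negPf li) orbF in lo.
  by apply: allpairs_f_dep; rewrite ?mem_filter ?mem_iota ?lo /= /n; lia.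
have le : size (mrc_pairs w) <= size all.
  rewrite -(size_map (light_charge w)); apply: uniq_leq_size sub.
  by rewrite map_inj_in_uniq ?uniq_mrc_pairs //; apply: light_charge_inj.
apply: leq_trans le _; rewrite size_allpairs leq_mul2l /=.
rewrite size_allpairs_dep sumnE big_map.
apply: (@leq_trans (\sum_(q <- iota 0 n.+1) trunc_log 2 n.+1)); last first.
  by rewrite big_const_seq count_predT size_iota iter_addn_0 mulnC.
rewrite big_seq [leqRHS]big_seq; apply: leq_sum => q; rewrite mem_iota => qn.
by rewrite size_filter count_light //; lia.
Qed.

Lemma sum_size_MRC_entry w :
  \sum_(i <- iota 1 (size w)) size (MRC_entry w i) = size (mrc_pairs w).
Proof.
rewrite size_allpairs_dep sumnE big_map -[1]/(1 + 0) iotaDl big_map.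
by apply: eq_bigr => i _; rewrite size_map size_rev.
Qed.
End Closed.

(** * Timed Hoare triples for the word RAM *)

Section Triples.
Variables (W : nat) (inp : seq nat).
Implicit Types (P Q : prog) (b : test) (s : state) (vs o : seq nat).
Implicit Types (x y z t u : nat).

(** A list of register values lets [set_nth] compute; registers beyond it hold 0. *)
Definition holds s vs o :=
  [/\ regs s =1 nth 0 vs, mem s =1 nth 0 inp & out s = o].

(* The memory is not a parameter since [holds] demands that it still be the
   input: only programs without stores satisfy such triples. *)
Definition runs P t vs o vs' o' := forall s, holds s vs o ->
  exists u s', [/\ exec W P s u s', u <= t & holds s' vs' o'].

Definition eval_regs b vs :=
  match b with
  | TEq x y => nth 0 vs x == nth 0 vs y
  | TLt x y => nth 0 vs x < nth 0 vs y
  end.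

Lemma eval_testE b s vs o : holds s vs o -> eval_test b s = eval_regs b vs.
Proof. by case: b => x y [rE _ _] /=; rewrite !rE. Qed.

Lemma runs_weaken P t u vs o vs' o' :
  runs P t vs o vs' o' -> t <= u -> runs P u vs o vs' o'.
Proof.
by move=> r tu s /r[v [s' [ex vt h]]]; exists v, s'; split; rewrite ?(leq_trans vt).
Qed.

Lemma holds_set_reg s vs o x v v' : v' %% 2 ^ W = v -> holds s vs o ->
  holds (set_reg W s x v') (set_nth 0 vs x v) o.
Proof. by move=> vE [rE mE oE]; split=> // r; rewrite nth_set_nth /= vE rE. Qed.

Lemma runs_skip vs o : runs Skip 1 vs o vs o.
Proof. by move=> s h; exists 1, s; split=> //; constructor. Qed.

Lemma runs_const x c vs o : c < 2 ^ W ->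
  runs (Const x c) 1 vs o (set_nth 0 vs x c) o.
Proof.
move=> cW s h; exists 1; eexists; split; [exact: EConst|by []|].
by apply: holds_set_reg h; rewrite modn_small.
Qed.

Lemma runs_add x y z vs o : nth 0 vs y + nth 0 vs z < 2 ^ W ->
  runs (Add x y z) 1 vs o (set_nth 0 vs x (nth 0 vs y + nth 0 vs z)) o.
Proof.
move=> lt s h; exists 1; eexists; split; [exact: EAdd|by []|].
by apply: holds_set_reg (h); case: h => rE _ _; rewrite !rE modn_small.
Qed.

Lemma runs_sub x y z vs o : nth 0 vs z <= nth 0 vs y < 2 ^ W ->
  runs (Sub x y z) 1 vs o (set_nth 0 vs x (nth 0 vs y - nth 0 vs z)) o.
Proof.
move=> /andP[le lt] s h; exists 1; eexists; split; [exact: ESub|by []|].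
apply: holds_set_reg (h); case: h => rE _ _; rewrite !rE -addnBAC //.
by rewrite modnDr modn_small //; lia.
Qed.

Lemma runs_load x y vs o : fits W inp ->
  runs (LoadMem x y) 1 vs o (set_nth 0 vs x (nth 0 inp (nth 0 vs y))) o.
Proof.
move=> /andP[sW /allP aW] s h; exists 1; eexists; split; [exact: ELoad|by []|].
apply: holds_set_reg (h); case: h => rE mE _; rewrite rE mE modn_small //.
have [lt|le] := ltnP (nth 0 vs y) (size inp); first by rewrite aW // mem_nth.
by rewrite nth_default // expn_gt0.
Qed.

Lemma runs_output x vs o : runs (Output x) 1 vs o vs (rcons o (nth 0 vs x)).
Proof.
move=> s h; exists 1; eexists; split; [exact: EOutput|by []|].
by case: h => rE mE <-; split=> //=; rewrite rE.
Qed.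

Lemma runs_seq P Q t u vs0 o0 vs1 o1 vs2 o2 :
  runs P t vs0 o0 vs1 o1 -> runs Q u vs1 o1 vs2 o2 ->
  runs (Seq P Q) (t + u) vs0 o0 vs2 o2.
Proof.
move=> rP rQ s /rP[t' [s' [eP tt /rQ[u' [s'' [eQ uu h]]]]]].
by exists (t' + u'), s''; split=> //; [exact: ESeq eP eQ | exact: leq_add].
Qed.

Lemma runs_if b P Q t vs o vs' o' :
  runs (if eval_regs b vs then P else Q) t vs o vs' o' ->
  runs (If b P Q) t.+1 vs o vs' o'.
Proof.
move=> r s h; have [u [s' [ex ut h']]] := r s h.
by exists u.+1, s'; split=> //; apply: EIf; rewrite (eval_testE _ h).
Qed.

Lemma runs_while_false b P vs o : ~~ eval_regs b vs ->
  runs (While b P) 1 vs o vs o.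
Proof.
move=> nb s h; exists 1, s; split=> //.
by apply: EWhileF; rewrite (eval_testE _ h).
Qed.

Lemma runs_while_true b P t u vs0 o0 vs1 o1 vs2 o2 : eval_regs b vs0 ->
  runs P t vs0 o0 vs1 o1 -> runs (While b P) u vs1 o1 vs2 o2 ->
  runs (While b P) (t + u).+1 vs0 o0 vs2 o2.
Proof.
move=> bT rP rW s h; have [t' [s' [eP tt /rW[u' [s'' [eW uu h']]]]]] := rP s h.
exists (t' + u').+1, s''; split=> //; last by rewrite ltnS leq_add.
by apply: EWhileT eP eW; rewrite (eval_testE _ h).
Qed.

End Triples.

(* Register 0 holds 0, register 1 holds 1, register 2 holds n, register 3 the
   start i, register 4 the reading position in the input, register 5 w[i-1],
   register 6 the number of pairs of MRC[i] left; 7 and 8 are scratch.  The lists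
   of MRC are stored contiguously, so the table of their addresses is not read. *)
Definition emit := Seq (Output 3) (Output 7).

Definition pair_step :=
  Seq (Sub 6 6 1) (Seq (LoadMem 7 4) (Seq (Add 4 4 1)
  (Seq (LoadMem 8 4) (Seq (Add 4 4 1)
  (Seq (Add 7 3 7) (Seq (Sub 7 7 1) (Seq (Sub 8 7 8) (Seq (LoadMem 8 8)
  (If (TEq 3 1) emit (If (TEq 5 8) Skip emit)))))))))).

Definition pairs_loop := While (TLt 0 6) pair_step.

(* For i = 1, register 5 receives n, which is not used. *)
Definition position_step :=
  Seq (LoadMem 5 3) (Seq (Add 3 3 1) (Seq (LoadMem 6 4) (Seq (Add 4 4 1)
  pairs_loop))).

Definition mcs_prog :=
  Seq (LoadMem 2 0) (Seq (Const 1 1) (Seq (Add 4 2 2) (Seq (Add 4 4 1)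
  (While (TLt 3 2) position_step)))).

(** * Output and running time of the program *)

Section McsProg.
Variables (W : nat) (inp : seq nat).
Hypothesis inpW : fits W inp.

Definition mcs_end i (e : nat * nat) := i + e.1 - 1.

(** Letters are stored from cell 1 on, so these cells hold the letters before the two copies of the
    border. *)
Definition kept i (e : nat * nat) :=
  (i == 1) || (nth 0 inp i.-1 != nth 0 inp (mcs_end i e - e.2)).

Definition kept_pairs i (E : seq (nat * nat)) :=
  [seq (i, mcs_end i e) | e <- E & kept i e].

(** These bounds keep the arithmetic of [pair_step] from wrapping around modulo [2 ^ W]. *)
Definition fitting i (e : nat * nat) :=
  [&& 0 < e.1, i + e.1 <= size inp & e.2 <= mcs_end i e].

Lemma flat_pairs_cat (E F : seq (nat * nat)) :
  flat_pairs (E ++ F) = flat_pairs E ++ flat_pairs F.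
Proof. by rewrite /flat_pairs map_cat flatten_cat. Qed.

Lemma runs_emit vs o :
  runs W inp emit 2 vs o vs (o ++ [:: nth 0 vs 3; nth 0 vs 7]).
Proof.
by rewrite -cat1s catA !cats1; apply: (@runs_seq _ _ _ _ 1 1);
  apply: runs_output.
Qed.

Lemma size_flat_pairs (E : seq (nat * nat)) :
  size (flat_pairs E) = 2 * size E.
Proof.
by elim: E => //= e E; rewrite -[flatten _]/(flat_pairs E); lia.
Qed.

(** The 13 units are nine basic instructions, at most two tests and at most two outputs. *)
Lemma runs_pair_step n i c e pre suf a b o :
  inp = pre ++ [:: e.1; e.2] ++ suf -> 0 < i -> fitting i e -> 0 < c < 2 ^ W ->
  exists b', runs W inp pair_step 13
    [:: 0; 1; n; i; size pre; nth 0 inp i.-1; c; a; b] o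
    [:: 0; 1; n; i; (size pre).+2; nth 0 inp i.-1; c.-1; mcs_end i e; b']
    (o ++ flat_pairs (kept_pairs i [:: e])).
Proof.
move=> inpE i0 /and3P[e0 ei ek] cW; have /andP[sW _] := inpW.
have le_sz : (size pre).+2 <= size inp by rewrite inpE !size_cat /=; lia.
have E1 : nth 0 inp (size pre) = e.1.
  by rewrite inpE nth_cat ltnn subnn.
have E2 : nth 0 inp (size pre).+1 = e.2.
  by rewrite inpE nth_cat ltnNge leqnSn subSnn.
exists (nth 0 inp (mcs_end i e - e.2)).
eapply runs_weaken.
  eapply runs_seq; first by apply: runs_sub => /=; lia.
  eapply runs_seq; first by apply: runs_load.
  eapply runs_seq; first by apply: runs_add => /=; lia.
  eapply runs_seq; first by apply: runs_load.
  eapply runs_seq; first by apply: runs_add => /=; lia.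
  eapply runs_seq; first by apply: runs_add => /=; rewrite E1; lia.
  eapply runs_seq; first by apply: runs_sub => /=; rewrite E1; lia.
  eapply runs_seq.
    apply: runs_sub => /=; rewrite E1 addn1 E2 -/(mcs_end i e) ek.
    by rewrite /mcs_end; lia.
  eapply runs_seq; first by apply: runs_load.
  rewrite /= !addn1 E1 E2 -/(mcs_end i e) subn1;
    apply: (@runs_weaken _ _ _ 4) (leqnn _).
  rewrite /kept_pairs /= /kept; apply: runs_if => /=.
  case: (i == 1) => /=.
    by apply: (@runs_weaken _ _ _ 2) => //; apply: runs_emit.
  apply: runs_if => /=; case: eqP => _ /=; last exact: runs_emit.
  by rewrite cats0; apply: (@runs_weaken _ _ _ 1) => //; apply: runs_skip.
by [].
Qed.

(** The induction moves each pair read from [E] to [pre], whose size is the reading position. A pair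
    costs 13 units and a loop test; the last unit is the failing test. *)
Lemma runs_pairs_loop n i E pre suf a b o :
  inp = pre ++ flat_pairs E ++ suf -> 0 < i -> all (fitting i) E ->
  exists a' b', runs W inp pairs_loop (14 * size E).+1
    [:: 0; 1; n; i; size pre; nth 0 inp i.-1; size E; a; b] o
    [:: 0; 1; n; i; size (pre ++ flat_pairs E); nth 0 inp i.-1; 0; a'; b']
    (o ++ flat_pairs (kept_pairs i E)).
Proof.
elim: E pre a b o => [|e E IH] pre a b o inpE i0 /=.
  move=> _; exists a, b; rewrite !cats0.
  by apply: (@runs_weaken _ _ _ 1) => //; apply: runs_while_false.
case/andP=> fe fE; have /andP[sW _] := inpW.
have cW : 0 < (size E).+1 < 2 ^ W.
  apply: leq_ltn_trans sW.
  by rewrite inpE !size_cat size_flat_pairs /=; lia.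
have inpE1 : inp = pre ++ [:: e.1; e.2] ++ flat_pairs E ++ suf by rewrite inpE.
have [b' r] := runs_pair_step n a b o inpE1 i0 fe cW.
have [|a1 [b1 r1]] := IH (pre ++ [:: e.1; e.2]) (mcs_end i e) b'
  (o ++ flat_pairs (kept_pairs i [:: e])) _ i0 fE; first by rewrite -catA.
exists a1, b1; eapply runs_weaken.
  eapply runs_while_true; [by []|exact: r|].
  move: r1; rewrite size_cat addn2 -!catA -flat_pairs_cat /kept_pairs -map_cat.
  by rewrite -filter_cat; apply.
by lia.
Qed.

(** Besides 14 units per pair, a position costs four instructions and two loop tests, well below
    20. *)
Lemma runs_positions n (f : nat -> seq (nat * nat)) k i pre c a b v o :
  inp = pre ++ flatten [seq encode_list (f j) | j <- iota i.+1 k] ->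
  (forall j, i < j <= n -> all (fitting j) (f j)) -> n = i + k ->
  n < size inp ->
  exists vs, runs W inp (While (TLt 3 2) position_step)
    (20 * k + 14 * \sum_(j <- iota i.+1 k) size (f j)).+1
    [:: 0; 1; n; i; size pre; v; c; a; b] o vs
    (o ++ flat_pairs (flatten [seq kept_pairs j (f j) | j <- iota i.+1 k])).
Proof.
elim: k i pre c a b v o => [|k IH] i pre c a b v o inpE fit nE ni.
  exists [:: 0; 1; n; i; size pre; v; c; a; b]; rewrite cats0.
  by apply: (@runs_weaken _ _ _ 1) => //; apply: runs_while_false => /=; lia.
have /andP[sW _] := inpW.
set rest := flatten [seq encode_list (f j) | j <- iota i.+2 k].
have inpE1 : inp = (rcons pre (size (f i.+1))) ++ flat_pairs (f i.+1) ++ rest.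
  by rewrite inpE /= -/rest -cats1 -!catA.
have sz : size pre < size inp by rewrite inpE1 size_cat size_rcons; lia.
have E1 : nth 0 inp (size pre) = size (f i.+1).
  by rewrite inpE1 nth_cat size_rcons ltnSn nth_rcons ltnn eqxx.
have [|a1 [b1]] := runs_pairs_loop n a b o inpE1 (ltn0Sn i).
  by apply: fit; lia.
rewrite size_rcons => r.
have [|||vs rs] := IH i.+1 (rcons pre (size (f i.+1)) ++ flat_pairs (f i.+1)) 0
  a1 b1 (nth 0 inp i) (o ++ flat_pairs (kept_pairs i.+1 (f i.+1))) _ _ _ ni.
- by rewrite -catA.
- by move=> j ij; apply: fit; lia.
- by rewrite nE addSnnS.
exists vs; eapply runs_weaken.
  eapply runs_while_true; first by rewrite /= nE; lia.
    eapply runs_seq; first by apply: runs_load.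
    eapply runs_seq; first by apply: runs_add => /=; lia.
    eapply runs_seq; first by apply: runs_load.
    eapply runs_seq; first by apply: runs_add => /=; lia.
    rewrite /= !addn1 E1; exact: r.
  by rewrite /= flat_pairs_cat catA; exact: rs.
by rewrite big_cons -/(iota _ _) /=; lia.
Qed.

Lemma runs_mcs_prog n (f : nat -> seq (nat * nat)) pre :
  inp = pre ++ flatten [seq encode_list (f j) | j <- iota 1 n] ->
  size pre = (2 * n).+1 -> nth 0 inp 0 = n ->
  (forall j, 0 < j <= n -> all (fitting j) (f j)) ->
  exists vs, runs W inp mcs_prog
    (20 * n + 14 * \sum_(j <- iota 1 n) size (f j) + 5) (nseq 9 0) [::] vs
    (flat_pairs (flatten [seq kept_pairs j (f j) | j <- iota 1 n])).
Proof.
move=> inpE pre_sz inp0 fit; have /andP[sW _] := inpW.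
have lt : 2 * n < size inp by rewrite inpE size_cat; lia.
have ni : n < size inp by lia.
have [vs r] := runs_positions 0 0 0 0 [::] inpE fit (erefl n) ni.
exists vs; eapply runs_weaken.
  eapply runs_seq; first by apply: runs_load.
  eapply runs_seq; first by apply: runs_const; lia.
  eapply runs_seq; first by apply: runs_add; rewrite /= inp0; lia.
  eapply runs_seq; first by apply: runs_add; rewrite /= inp0; lia.
  (* Register 4 now holds [n + n + 1], the address of the first list. *)
  by rewrite /= inp0 addnn -mul2n addn1 -pre_sz; exact: r.
by lia.
Qed.

End McsProg.

(** * The program on an encoded word and its [MRC] array *)

Section Encoding.
Variable w : seq nat.
Let n := size w.
Let inp := encode_input w (MRC w).

Let addrs := [seq (2 * n).+1 + sumn (take k (shape [seq encode_list E | E <- MRC w]))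
             | k <- iota 0 n].

Lemma encode_inputE : inp = (n :: w ++ addrs) ++
  flatten [seq encode_list (MRC_entry w i) | i <- iota 1 n].
Proof.
rewrite cat_cons -catA; congr (_ :: _ ++ _ ++ flatten _).
by rewrite /MRC -map_comp.
Qed.

Lemma nth_encode_input i : 0 < i <= n -> nth 0 inp i = nth 0 w i.-1.
Proof. by case: i => // i; rewrite encode_inputE /= -catA nth_cat /n => ->. Qed.

Lemma size_encode_input : 2 * n < size inp.
Proof.
rewrite encode_inputE size_cat /= size_cat size_map size_iota -/n; lia.
Qed.

Lemma MRC_entry_fitting i : 0 < i <= n -> all (fitting inp i) (MRC_entry w i).
Proof.
case: i => // i _; apply/allP=> _ /mapP[j + ->].
rewrite mem_rev mem_filter => /andP[m _].
have [lt _ _ pk _] := max_right_closed_border m.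
have /and5P[_ ij jn _ _] := m.
have := size_encode_input; rewrite /fitting /mcs_end /= size_substr //.
by move: pk lt jn; rewrite -/n; lia.
Qed.

Definition mcs_list := flatten
  [seq kept_pairs inp i (MRC_entry w i) | i <- iota 1 n].

Let entry i j := (size (substr w i j), longest_border (substr w i j)).

Lemma mcs_end_entry i j : max_right_closed w i j -> mcs_end i (entry i j) = j.
Proof.
by case/and5P=> i0 ij jn _ _; rewrite /mcs_end /= size_substr; lia.
Qed.

Lemma kept_entry i j : max_right_closed w i j ->
  kept inp i (entry i j) = max_left_closed w i j.
Proof.
move=> m; rewrite (max_left_closedE 0 m) /kept mcs_end_entry //=.
have /and5P[i0 ij jn _ _] := m; case: eqP => //= i1.
case: i i0 i1 ij m => [//|i] _ i1 ij m.
have [lt _ _ pk _] := max_right_closed_border m.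
by rewrite !nth_encode_input //; rewrite -/n in jn lt; lia.
Qed.

Lemma kept_pairs_MRC i :
  kept_pairs inp i (MRC_entry w i) =
  [seq (i, j) | j <- rev [seq j <- iota 1 n | MCS w i j]].
Proof.
rewrite /kept_pairs filter_map -map_comp filter_rev -filter_predI.
have -> : [seq j <- iota 1 n | MCS w i j] =
    [seq j <- iota 1 n | kept inp i (entry i j) && max_right_closed w i j].
  apply: eq_filter => j; rewrite /MCS; have [m|] := boolP (max_right_closed w i j).
    by rewrite kept_entry.
  by rewrite !andbF.
apply/eq_in_map => j; rewrite mem_rev mem_filter => /andP[/andP[_ m] _].
by congr pair; apply: mcs_end_entry.
Qed.

Lemma mcs_listE :
  mcs_list = [seq (i, j) | i <- iota 1 n, j <- rev [seq j <- iota 1 n | MCS w i j]].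
Proof.
by congr flatten; apply: eq_map => i; apply: kept_pairs_MRC.
Qed.

Lemma mem_mcs_list (i j : nat) : ((i, j) \in mcs_list) = MCS w i j.
Proof.
rewrite mcs_listE; apply/allpairsPdep/idP => [[i' [j' [_ + [-> ->]]]]|m].
  by rewrite mem_rev mem_filter => /andP[].
exists i, j; rewrite mem_rev mem_filter m !mem_iota.
by case/andP: m => /and5P[i0 ij jn _ _] _; split=> //;
  rewrite add1n ltnS ?i0 ?(leq_trans ij jn) ?(leq_trans i0 ij).
Qed.

Lemma uniq_mcs_list : uniq mcs_list.
Proof.
rewrite mcs_listE; apply: allpairs_uniq_dep => [|i _|[i j] [i' j'] _ _ [-> ->] //].
  exact: iota_uniq.
by rewrite rev_uniq filter_uniq ?iota_uniq.
Qed.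

Lemma size_addrs : size (n :: w ++ addrs) = (2 * n).+1.
Proof. by rewrite /= size_cat size_map size_iota -/n addnn mul2n. Qed.

End Encoding.

(** From [n.+1 <= 2 * n] the logarithm of [n.+1] is at most [l + 1]. Expanding
    [28 * (n + 1) * (l + 1)] and bounding [n], [l] and 1 by [n * l] gives
    [20 + 28 * 4 + 5 = 137]. *)
Lemma MRC_time n S : 2 <= n -> S <= 2 * (n.+1 * trunc_log 2 n.+1) ->
  20 * n + 14 * S + 5 <= 137 * (n * trunc_log 2 n).
Proof.
move=> n2 le; set l := trunc_log 2 n.
have l0 : 0 < l by rewrite trunc_log_gt0.
have le2 : trunc_log 2 n.+1 <= l.+1.
  by rewrite -trunc_log2_double ?leq_trunc_log //; lia.
by move: le; move: (trunc_log 2 n.+1) le2 => l' le2 le; nia.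
Qed.

Theorem theorem5 :
  exists (P : prog) (C : nat),
  forall (W : nat) (w : seq nat),
    fits W (encode_input w (MRC w)) ->
    exists (t : nat) (s : state) (L : seq (nat * nat)),
      [/\ exec W P (init (encode_input w (MRC w))) t s,
          out s = flat_pairs L,
          uniq L,
          (forall i j : nat, ((i, j) \in L) = MCS w i j)
        & 2 <= size w -> t <= C * (size w * trunc_log 2 (size w))].
Proof.
exists mcs_prog, 137 => W w inpW.
have [vs r] := runs_mcs_prog inpW (encode_inputE w) (size_addrs w) (erefl _)
  (@MRC_entry_fitting w).
have [|t [s [ex le [_ _ outs]]]] := r (init (encode_input w (MRC w))).
  by split=> // x; rewrite nth_nseq if_same.
exists t, s, (mcs_list w); split=> //.
- exact: uniq_mcs_list.
- exact: mem_mcs_list.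
move=> n2; apply: leq_trans le _; rewrite sum_size_MRC_entry.
exact: MRC_time n2 (size_mrc_pairs w).
Qed.
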